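(* Let $k$ be a field of characteristic zero, let $(\mathcal{A},[\cdot,\cdot],\triangleright)$ be a post-Lie algebra over $k$, let $\mathfrak{g}=(\mathcal{A},[\cdot,\cdot])$, and let $\triangleright$ also denote the extension of the post-Lie product to $\mathcal{U}(\mathfrak{g})$. The product on $\mathcal{U}(\mathfrak{g})$ defined by $$A*B := A_{(1)}(A_{(2)}\triangleright B)$$ is associative. Moreover, $(\mathcal{U}(\mathfrak{g}),*,\Delta)$ is a Hopf algebra.
   Context: A post-Lie algebra $(\mathcal{A},[\cdot,\cdot],\triangleright)$ is a Lie algebra $\mathfrak{g}=(\mathcal{A},[\cdot,\cdot])$ together with a bilinear product $\triangleright:\mathcal{A}\times\mathcal{A}\to\mathcal{A}$ such that for all $x,y,z$: $x\triangleright[y,z]=[x\triangleright y,z]+[y,x\triangleright z]$ and $[x,y]\triangleright z=a_\triangleright(x,y,z)-a_\triangleright(y,x,z)$, where $a_\triangleright(x,y,z)=x\triangleright(y\triangleright z)-(x\triangleright y)\triangleright z$. $\mathcal{U}(\mathfrak{g})$ is the universal enveloping algebra with unit $\mathbf{1}$ and product written as concatenation. $\Delta$ is the coshuffle coproduct: the algebra morphism (for concatenation) with $\Delta(x)=x\otimes\mathbf{1}+\mathbf{1}\otimes x$ for $x\in\mathfrak{g}$. Sweedler notation $\Delta(A)=A_{(1)}\otimes A_{(2)}$ is used. The product $\triangleright$ extends uniquely from $\mathfrak{g}$ to a bilinear product on $\mathcal{U}(\mathfrak{g})$ satisfying, for $A,B,C\in\mathcal{U}(\mathfrak{g})$, $x,y\in\mathfrak{g}$: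 $\mathbf{1}\triangleright A=A$; $(xA)\triangleright y=x\triangleright(A\triangleright y)-(x\triangleright A)\triangleright y$; $A\triangleright(BC)=(A_{(1)}\triangleright B)(A_{(2)}\triangleright C)$. *)

(* Defs.v *)
From HB Require Import structures.
From mathcomp Require Import all_boot all_order all_algebra.
From mathcomp Require Import generic_quotient sesquilinear.
From mathcomp Require Import boolp classical_sets.

Set Implicit Arguments.
Unset Strict Implicit.
Unset Printing Implicit Defensive.

Import GRing.Theory.
Local Open Scope ring_scope.

Notation is_bilinear f := (bilinear_for *:%R *:%R f).

Section BilinearTheory.
Variables (k : fieldType) (V W X : lmodType k) (f : V -> W -> X).
Hypothesis bf : is_bilinear f.

Lemma bilinDl u v w : f (u + v) w = f u w + f v w.
Proof. by have := bf.1 w 1 u v; rewrite /= !scale1r. Qed.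

Lemma bilin0l w : f 0 w = 0.
Proof. by apply: (addIr (f 0 w)); rewrite -bilinDl !add0r. Qed.

Lemma bilinZl a u w : f (a *: u) w = a *: f u w.
Proof. by have := bf.1 w a u 0; rewrite /= bilin0l !addr0. Qed.

Lemma bilinDr u v w : f u (v + w) = f u v + f u w.
Proof. by have := bf.2 u 1 v w; rewrite /= !scale1r. Qed.

Lemma bilin0r u : f u 0 = 0.
Proof. by apply: (addIr (f u 0)); rewrite -bilinDr !add0r. Qed.

Lemma bilinZr a u w : f u (a *: w) = a *: f u w.
Proof. by have := bf.2 u a w 0; rewrite /= bilin0r !addr0. Qed.

End BilinearTheory.

Section Tensor.
Variables (k : fieldType) (V W : lmodType k).

(* A list [:: (v1, w1); ...; (vn, wn)] stands for the formal sum of the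
   v_i (x) w_i; two lists denote the same tensor when no bilinear map can
   separate them. *)
Definition tsum (X : lmodType k) (f : V -> W -> X) (s : seq (V * W)) : X :=
  \sum_(p <- s) f p.1 p.2.

Definition teq (s t : seq (V * W)) : bool :=
  `[< forall (X : lmodType k) (f : V -> W -> X),
        is_bilinear f -> tsum f s = tsum f t >].

Lemma teq_refl : reflexive teq.
Proof. by move=> s; apply/asboolP. Qed.

Lemma teq_sym : symmetric teq.
Proof.
by move=> s t; apply/asboolP/asboolP => h X f bf; rewrite h.
Qed.

Lemma teq_trans : transitive teq.
Proof.
move=> t s u /asboolP st /asboolP tu; apply/asboolP => X f bf.
by rewrite st // tu.
Qed.

Canonical teq_equiv := EquivRel teq teq_refl teq_sym teq_trans.

Definition tensor : Type := {eq_quot teq_equiv}%qT.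

HB.instance Definition _ := Choice.on tensor.

Definition tclass (s : seq (V * W)) : tensor := (\pi_({eq_quot teq_equiv}) s)%qT.

(* Sweedler's notation: the sum of f p.1 p.2 over p in sweedler t stands for
   f t_(1) t_(2).  It does not depend on the chosen representative when f is
   bilinear (tlift_class). *)
Definition sweedler (t : tensor) : seq (V * W) :=
  (repr (t : {eq_quot teq_equiv}))%qT.

Definition tens (v : V) (w : W) : tensor := tclass [:: (v, w)].

(* The linear map induced by f, meaningful when f is bilinear. *)
Definition tlift (X : lmodType k) (f : V -> W -> X) (t : tensor) : X :=
  \sum_(p <- sweedler t) f p.1 p.2.

Lemma tlift_class (X : lmodType k) (f : V -> W -> X) s :
  is_bilinear f -> tlift f (tclass s) = tsum f s.
Proof.
move=> bf; have: teq (sweedler (tclass s)) s.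
  have /eqmodP := reprK (tclass s : {eq_quot teq_equiv}%qT); exact.
by move/asboolP; apply.
Qed.

Lemma tensorP (s t : tensor) :
  (forall (X : lmodType k) (f : V -> W -> X),
     is_bilinear f -> tlift f s = tlift f t) -> s = t.
Proof.
move=> h; rewrite -(reprK (s : {eq_quot teq_equiv}%qT)).
rewrite -(reprK (t : {eq_quot teq_equiv}%qT)).
by apply/eqmodP/asboolP => X f bf; exact: h.
Qed.

Definition tadd (s t : tensor) := tclass (sweedler s ++ sweedler t).
Definition tscale (a : k) (t : tensor) :=
  tclass [seq (a *: p.1, p.2) | p <- sweedler t].
Definition topp (t : tensor) := tscale (-1) t.
Definition tzero : tensor := tclass [::].

Section Lift.
Variables (X : lmodType k) (f : V -> W -> X).
Hypothesis bf : is_bilinear f.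

Lemma tlift_tens v w : tlift f (tens v w) = f v w.
Proof. by rewrite tlift_class // /tsum big_seq1. Qed.

Lemma tlift_zero : tlift f tzero = 0.
Proof. by rewrite tlift_class // /tsum big_nil. Qed.

Lemma tlift_add s t : tlift f (tadd s t) = tlift f s + tlift f t.
Proof. by rewrite tlift_class // /tsum big_cat. Qed.

Lemma tlift_scale a t : tlift f (tscale a t) = a *: tlift f t.
Proof.
rewrite tlift_class // /tsum big_map scaler_sumr.
by apply: eq_bigr => p _; rewrite bilinZl.
Qed.

Lemma tlift_opp t : tlift f (topp t) = - tlift f t.
Proof. by rewrite tlift_scale scaleN1r. Qed.

End Lift.

Fact taddA : associative tadd.
Proof. by move=> r s t; apply: tensorP => X f bf; rewrite !tlift_add // addrA. Qed.
Fact taddC : commutative tadd.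
Proof. by move=> s t; apply: tensorP => X f bf; rewrite !tlift_add // addrC. Qed.
Fact tadd0 : left_id tzero tadd.
Proof.
by move=> s; apply: tensorP => X f bf; rewrite tlift_add // tlift_zero // add0r.
Qed.
Fact taddN : left_inverse tzero topp tadd.
Proof.
move=> s; apply: tensorP => X f bf.
by rewrite tlift_add // tlift_opp // tlift_zero // addNr.
Qed.

HB.instance Definition _ := GRing.isZmodule.Build tensor taddA taddC tadd0 taddN.

Fact tscaleA a b t : tscale a (tscale b t) = tscale (a * b) t.
Proof. by apply: tensorP => X f bf; rewrite !tlift_scale // scalerA. Qed.
Fact tscale1 : left_id 1 tscale.
Proof. by move=> t; apply: tensorP => X f bf; rewrite tlift_scale // scale1r. Qed.
Fact tscaleDr : right_distributive tscale +%R.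
Proof.
move=> a s t; apply: tensorP => X f bf.
by rewrite tlift_scale // !tlift_add // !tlift_scale // scalerDr.
Qed.
Fact tscaleDl t : {morph tscale^~ t : a b / a + b}.
Proof.
move=> a b; apply: tensorP => X f bf.
by rewrite tlift_add // !tlift_scale // scalerDl.
Qed.

HB.instance Definition _ := GRing.Zmodule_isLmodule.Build k tensor
  tscaleA tscale1 tscaleDr tscaleDl.

Lemma tlift_linear (X : lmodType k) (f : V -> W -> X) :
  is_bilinear f -> linear (tlift f).
Proof. by move=> bf a s t; rewrite tlift_add // tlift_scale. Qed.

Lemma tens_bilinear : is_bilinear tens.
Proof.
split=> [w | v] a u u'; apply: tensorP => X f bf.
all: rewrite tlift_linear // !tlift_tens //.
  by rewrite (bilinDl bf) (bilinZl bf).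
by rewrite (bilinDr bf) (bilinZr bf).
Qed.

Lemma tensorE (t : tensor) : t = \sum_(p <- sweedler t) tens p.1 p.2.
Proof.
rewrite -[LHS](reprK (t : {eq_quot teq_equiv}%qT)) -/(tclass _) -/(sweedler _).
elim: (sweedler t) => [|p s IHs]; first by rewrite big_nil.
rewrite big_cons -IHs; apply: tensorP => X f bf.
by rewrite tlift_add // !tlift_class // /tsum big_cons big_seq1.
Qed.

Lemma tlift_unique (X : lmodType k) (f : V -> W -> X) (g : tensor -> X) :
  is_bilinear f -> linear g -> (forall v w, g (tens v w) = f v w) ->
  g =1 tlift f.
Proof.
move=> bf lg gf t; rewrite [in LHS](tensorE t) /tlift.
pose G := HB.pack_for {linear tensor -> X} g (GRing.isLinear.Build _ _ _ _ g lg).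
by rewrite [LHS](linear_sum G); apply: eq_bigr => p _ /=; rewrite gf.
Qed.

End Tensor.

Arguments tlift {k V W X} f t.
Arguments tens {k V W} v w.
Arguments sweedler {k V W} t.

Section TensorOperations.
Variable k : fieldType.

Definition tmap (V V' W W' : lmodType k) (f : V -> V') (g : W -> W') :
    tensor V W -> tensor V' W' :=
  tlift (fun v w => tens (f v) (g w)).

Definition tassoc (U V W : lmodType k) :
    tensor (tensor U V) W -> tensor U (tensor V W) :=
  tlift (fun s w => tlift (fun u v => tens u (tens v w)) s).

(* The componentwise product (v (x) w)(v' (x) w') = m v v' (x) n w w'. *)
Definition tmul (V W : lmodType k) (m : V -> V -> V) (n : W -> W -> W)
    (s t : tensor V W) : tensor V W :=
  tlift (fun v w => tlift (fun v' w' => tens (m v v') (n w w')) t) s.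

Section Tmul.
Variables (V W : lmodType k) (m : V -> V -> V) (n : W -> W -> W).
Hypotheses (bm : is_bilinear m) (bn : is_bilinear n).

Lemma tmul_inner_bilinear v w :
  is_bilinear (fun v' w' => tens (m v v') (n w w')).
Proof.
have bt := @tens_bilinear k V W.
split=> [w' | v'] a u u' /=.
  by rewrite (bilinDr bm) (bilinZr bm) (bilinDl bt) (bilinZl bt).
by rewrite (bilinDr bn) (bilinZr bn) (bilinDr bt) (bilinZr bt).
Qed.

Lemma tmul_outer_bilinear t :
  is_bilinear (fun v w => tlift (fun v' w' => tens (m v v') (n w w')) t).
Proof.
have bt := @tens_bilinear k V W.
split=> [w | v] a u u' /=; rewrite /tlift scaler_sumr -big_split /=;
  apply: eq_bigr => p _.
  by rewrite (bilinDl bm) (bilinZl bm) (bilinDl bt) (bilinZl bt).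
by rewrite (bilinDl bn) (bilinZl bn) (bilinDr bt) (bilinZr bt).
Qed.

Lemma tmul_tens v w v' w' :
  tmul m n (tens v w) (tens v' w') = tens (m v v') (n w w').
Proof.
rewrite /tmul (tlift_tens (tmul_outer_bilinear _)).
by rewrite (tlift_tens (tmul_inner_bilinear _ _)).
Qed.

Lemma tmul_bilinear : is_bilinear (tmul m n).
Proof.
split=> [t | s] a u u'; first exact: (tlift_linear (tmul_outer_bilinear t)).
rewrite /tmul ![tlift _ s]/tlift /= scaler_sumr -big_split /=; apply: eq_bigr => p _.
exact: (tlift_linear (tmul_inner_bilinear _ _)).
Qed.

End Tmul.

End TensorOperations.

Section UnitFunctional.
Variables (k : fieldType) (A : algType k).

Lemma exists_unit_functional : exists f : A -> k^o, linear f /\ f 1 = 1.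
Proof.
pose P (S : set A) := (forall a x y, S x -> S y -> S (a *: x + y)) /\ ~ S 1.
have [M [[Mlin M1] Mmax]] : exists M, P M /\ forall B, (M `<` B)%classic -> ~ P B.
  apply: Zorn_bigcup => F FP Ftot; split=> [a x y [S FS Sx] [T FT Ty] | [S FS S1]].
    have [ST | TS] := Ftot S T FS FT.
      by exists T => //; apply: (FP T FT).1 => //; apply: ST.
    by exists S => //; apply: (FP S FS).1 => //; apply: TS.
  exact: (FP S FS).2.
have M0 : M 0.
  apply: contrapT => M0; pose B : set A := fun x => x = 0 \/ M x.
  have nM x : ~ M x.
    by move=> Mx; apply: M0; have := Mlin (-1) x x Mx Mx; rewrite scaleN1r addNr.
  apply: (Mmax B).
    by split=> [x Mx|]; [right | move=> /(_ 0 (or_introl erefl))/nM].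
  split=> [a x y [-> | /nM //] [-> | /nM //]|]; first by left; rewrite scaler0 addr0.
  by move=> [/eqP | /nM //]; rewrite oner_eq0.
have MZ a x : M x -> M (a *: x) by move=> Mx; rewrite -[_ *: _]addr0; apply: Mlin.
have MB x y : M x -> M y -> M (x - y).
  by move=> Mx My; rewrite addrC -scaleN1r; apply: Mlin.
have dec v : exists c : k, M (v - c%:A).
  apply: contrapT => nv.
  pose B : set A := fun x => exists2 c : k, M (x - c *: v) & True.
  have nMv : ~ M v by move=> Mv; apply: nv; exists 0; rewrite scale0r subr0.
  apply: (Mmax B).
    split=> [x Mx | /(_ v)]; first by exists 0; rewrite ?scale0r ?subr0.
    by move=> h; apply/nMv/h; exists 1; rewrite ?scale1r ?subrr.
  split=> [a x y [c Mc _] [d Md _] | [c Mc _]].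
    exists (a * c + d) => //.
    have -> : a *: x + y - (a * c + d) *: v = a *: (x - c *: v) + (y - d *: v).
      by rewrite scalerBr scalerDl scalerA opprD addrACA.
    exact: Mlin.
  have c0 : c != 0.
    by apply/eqP => c0; apply: M1; rewrite c0 scale0r subr0 in Mc.
  apply: nv; exists c^-1.
  have := MZ (- c^-1) _ Mc.
  by rewrite scalerBr !scaleNr scalerA mulVf // scale1r opprK addrC.
have [f fP] := choice dec.
have fU v c : M (v - c%:A) -> f v = c.
  move=> Mc; apply/eqP; rewrite -subr_eq0; apply/negPn/negP => d0.
  apply: M1; have := MZ (f v - c)^-1 _ (MB _ _ Mc (fP v)).
  have -> : (v - c%:A) - (v - (f v)%:A) = (f v - c)%:A.
    by rewrite opprB addrC addrA subrK -scalerBl.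
  by rewrite scalerA mulVf // scale1r.
exists f; split=> [a x y | ].
  apply: fU; have := Mlin a _ _ (fP x) (fP y).
  by rewrite scalerBr addrACA -opprD scalerDl scalerA.
by apply: fU; rewrite scale1r subrr.
Qed.

End UnitFunctional.

Section TensorAlgebra.
Variables (k : fieldType) (A B : algType k).

Fact mul_bilinear (C : algType k) : is_bilinear (@GRing.mul C).
Proof.
split=> c a u v /=; first by rewrite mulrDl scalerAl.
by rewrite mulrDr scalerAr.
Qed.

Definition tamul (s t : tensor A B) : tensor A B := tmul *%R *%R s t.

Let bmul : is_bilinear tamul := tmul_bilinear (@mul_bilinear A) (@mul_bilinear B).
Let tamulE a b a' b' : tamul (tens a b) (tens a' b') = tens (a * a') (b * b').
Proof. exact: (tmul_tens (@mul_bilinear A) (@mul_bilinear B)). Qed.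

Let tensor_ind (P : tensor A B -> Prop) :
  P 0 -> (forall s t, P s -> P t -> P (s + t)) -> (forall a b, P (tens a b)) ->
  forall t, P t.
Proof. by move=> P0 PD Pt t; rewrite [t]tensorE; elim/big_ind: _ => // p _. Qed.

Fact tamulDl : left_distributive tamul +%R.
Proof. by move=> r s t; exact: (bilinDl bmul). Qed.
Fact tamulDr : right_distributive tamul +%R.
Proof. by move=> r s t; exact: (bilinDr bmul). Qed.
Fact tamul0l t : tamul 0 t = 0. Proof. exact: (bilin0l bmul). Qed.
Fact tamul0r t : tamul t 0 = 0. Proof. exact: (bilin0r bmul). Qed.

Fact tamulA : associative tamul.
Proof.
move=> r s t.
elim/tensor_ind: r => [|r r' IH IH'|a b]; rewrite ?tamul0l //.
  by rewrite !tamulDl IH IH'.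
elim/tensor_ind: s => [|s s' IH IH'|a' b']; rewrite ?(tamul0l, tamul0r) //.
  by rewrite !(tamulDl, tamulDr) IH IH'.
elim/tensor_ind: t => [|t t' IH IH'|a'' b'']; rewrite ?(tamul0l, tamul0r) //.
  by rewrite !(tamulDl, tamulDr) IH IH'.
by rewrite !tamulE !mulrA.
Qed.

Fact tamul1 : left_id (tens 1 1) tamul.
Proof.
elim/tensor_ind => [|s s' IH IH'|a b]; rewrite ?tamul0r //.
  by rewrite tamulDr IH IH'.
by rewrite tamulE !mul1r.
Qed.

Fact tamulr1 : right_id (tens 1 1) tamul.
Proof.
elim/tensor_ind => [|s s' IH IH'|a b]; rewrite ?tamul0l //.
  by rewrite tamulDl IH IH'.
by rewrite tamulE !mulr1.
Qed.

Fact tens11_neq0 : tens 1 1 != 0 :> tensor A B.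
Proof.
have [f [lf f1]] := exists_unit_functional A.
have [g [lg g1]] := exists_unit_functional B.
pose h a b : k^o := f a * g b.
have bh : is_bilinear h.
  split=> c a u v; first by rewrite /= /h lf mulrDl scalerAl.
  by rewrite /= /h lg mulrDr scalerAr.
apply/eqP => /(congr1 (tlift h)).
rewrite tlift_tens // tlift_zero // /h f1 g1 mulr1 => /eqP.
by rewrite oner_eq0.
Qed.

HB.instance Definition _ := GRing.Zmodule_isNzRing.Build (tensor A B)
  tamulA tamul1 tamulr1 tamulDl tamulDr tens11_neq0.

Fact tamulZl (a : k) (s t : tensor A B) : a *: (s * t) = (a *: s) * t.
Proof. by rewrite [RHS](bilinZl bmul). Qed.
HB.instance Definition _ := GRing.Lmodule_isLalgebra.Build k (tensor A B) tamulZl.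

Fact tamulZr (a : k) (s t : tensor A B) : a *: (s * t) = s * (a *: t).
Proof. by rewrite [RHS](bilinZr bmul). Qed.
HB.instance Definition _ := GRing.Lalgebra_isAlgebra.Build k (tensor A B) tamulZr.

Lemma tens_mul (a a' : A) (b b' : B) :
  tens a b * tens a' b' = tens (a * a') (b * b').
Proof. exact: tamulE. Qed.

Lemma tens_one : tens 1 1 = 1 :> tensor A B. Proof. by []. Qed.

End TensorAlgebra.

HB.mixin Record Lmodule_isLie (k : fieldType) L of GRing.Lmodule k L := {
  lie : L -> L -> L;
  lie_bilinear : is_bilinear lie;
  lie_alt : forall x, lie x x = 0;
  lie_jacobi : forall x y z,
    lie x (lie y z) + lie y (lie z x) + lie z (lie x y) = 0
}.

#[short(type="lieAlgType")]
HB.structure Definition LieAlgebra (k : fieldType) :=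
  {L of GRing.Lmodule k L & Lmodule_isLie k L}.

Definition associator (V : zmodType) (m : V -> V -> V) (x y z : V) : V :=
  m x (m y z) - m (m x y) z.

HB.mixin Record Lie_isPostLie (k : fieldType) A of LieAlgebra k A := {
  postlie : A -> A -> A;
  postlie_bilinear : is_bilinear postlie;
  postlie_lie : forall x y z : A,
    postlie x (lie y z) = lie (postlie x y) z + lie y (postlie x z);
  lie_postlie : forall x y z : A,
    postlie (lie x y) z = associator postlie x y z - associator postlie y x z
}.

#[short(type="postLieAlgType")]
HB.structure Definition PostLieAlgebra (k : fieldType) :=
  {A of LieAlgebra k A & Lie_isPostLie k A}.

Definition lie_hom (k : fieldType) (L : lieAlgType k) (B : algType k)
    (f : L -> B) : Prop :=
  linear f /\ forall x y, f (lie x y) = f x * f y - f y * f x.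

Section UniversalEnvelopingAlgebra.
Variables (k : fieldType) (L : lieAlgType k).

(* A list of pairs (c, [:: x1; ...; xn]) stands for the formal sum of the
   c . x1 ... xn; two lists denote the same element of the enveloping algebra
   when they have the same value in every associative algebra to which L maps
   by a morphism of Lie algebras. *)
Definition uterm : Type := seq (k * seq L).

Definition usum (B : algType k) (f : L -> B) (s : uterm) : B :=
  \sum_(p <- s) p.1 *: \prod_(x <- p.2) f x.

Definition ueq (s t : uterm) : bool :=
  `[< forall (B : algType k) (f : L -> B), lie_hom f -> usum f s = usum f t >].

Lemma ueq_refl : reflexive ueq.
Proof. by move=> s; apply/asboolP. Qed.

Lemma ueq_sym : symmetric ueq.
Proof. by move=> s t; apply/asboolP/asboolP => h B f hf; rewrite h. Qed.

Lemma ueq_trans : transitive ueq.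
Proof.
move=> t s u /asboolP st /asboolP tu; apply/asboolP => B f hf.
by rewrite st // tu.
Qed.

HB.instance Definition _ := Choice.on uterm.

Canonical ueq_equiv := EquivRel ueq ueq_refl ueq_sym ueq_trans.

Definition uea : Type := {eq_quot ueq_equiv}%qT.

HB.instance Definition _ := Choice.on uea.

Definition uclass (s : uterm) : uea := (\pi_({eq_quot ueq_equiv}) s)%qT.
Definition urepr (a : uea) : uterm := (repr (a : {eq_quot ueq_equiv}))%qT.

(* The algebra morphism induced by f, meaningful when f is a Lie morphism. *)
Definition ulift (B : algType k) (f : L -> B) (a : uea) : B := usum f (urepr a).

Lemma ulift_class (B : algType k) (f : L -> B) s :
  lie_hom f -> ulift f (uclass s) = usum f s.
Proof.
move=> hf; have: ueq (urepr (uclass s)) s.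
  have /eqmodP := reprK (uclass s : {eq_quot ueq_equiv}%qT); exact.
by move/asboolP; apply.
Qed.

Lemma ueaP (a b : uea) :
  (forall (B : algType k) (f : L -> B), lie_hom f -> ulift f a = ulift f b) ->
  a = b.
Proof.
move=> h; rewrite -(reprK (a : {eq_quot ueq_equiv}%qT)).
rewrite -(reprK (b : {eq_quot ueq_equiv}%qT)).
by apply/eqmodP/asboolP => B f hf; exact: h.
Qed.

Definition uzero : uea := uclass [::].
Definition uone : uea := uclass [:: (1, [::])].
Definition uadd (a b : uea) : uea := uclass (urepr a ++ urepr b).
Definition uscale (c : k) (a : uea) : uea :=
  uclass [seq (c * p.1, p.2) | p <- urepr a].
Definition uopp (a : uea) : uea := uscale (-1) a.
Definition umul (a b : uea) : uea :=
  uclass [seq (p.1 * q.1, p.2 ++ q.2) | p <- urepr a, q <- urepr b].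
Definition uiota (x : L) : uea := uclass [:: (1, [:: x])].

Section Lift.
Variables (B : algType k) (f : L -> B).
Hypothesis hf : lie_hom f.

Lemma ulift_zero : ulift f uzero = 0.
Proof. by rewrite ulift_class // /usum big_nil. Qed.

Lemma ulift_one : ulift f uone = 1.
Proof. by rewrite ulift_class // /usum big_seq1 big_nil scale1r. Qed.

Lemma ulift_iota x : ulift f (uiota x) = f x.
Proof. by rewrite ulift_class // /usum big_seq1 big_seq1 scale1r. Qed.

Lemma ulift_add a b : ulift f (uadd a b) = ulift f a + ulift f b.
Proof. by rewrite ulift_class // /usum big_cat. Qed.

Lemma ulift_scale c a : ulift f (uscale c a) = c *: ulift f a.
Proof.
rewrite ulift_class // /usum big_map scaler_sumr.
by apply: eq_bigr => p _; rewrite scalerA.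
Qed.

Lemma ulift_opp a : ulift f (uopp a) = - ulift f a.
Proof. by rewrite ulift_scale scaleN1r. Qed.

Lemma ulift_mul a b : ulift f (umul a b) = ulift f a * ulift f b.
Proof.
rewrite ulift_class // /usum big_allpairs_dep mulr_suml.
apply: eq_bigr => p _; rewrite mulr_sumr; apply: eq_bigr => q _ /=.
by rewrite big_cat /= -scalerAl -scalerAr scalerA.
Qed.

End Lift.

Fact uaddA : associative uadd.
Proof. by move=> a b c; apply: ueaP => B f hf; rewrite !ulift_add // addrA. Qed.
Fact uaddC : commutative uadd.
Proof. by move=> a b; apply: ueaP => B f hf; rewrite !ulift_add // addrC. Qed.
Fact uadd0 : left_id uzero uadd.
Proof.
by move=> a; apply: ueaP => B f hf; rewrite ulift_add // ulift_zero // add0r.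
Qed.
Fact uaddN : left_inverse uzero uopp uadd.
Proof.
move=> a; apply: ueaP => B f hf.
by rewrite ulift_add // ulift_opp // ulift_zero // addNr.
Qed.

HB.instance Definition _ := GRing.isZmodule.Build uea uaddA uaddC uadd0 uaddN.

Fact umulA : associative umul.
Proof. by move=> a b c; apply: ueaP => B f hf; rewrite !ulift_mul // mulrA. Qed.
Fact umul1 : left_id uone umul.
Proof.
by move=> a; apply: ueaP => B f hf; rewrite ulift_mul // ulift_one // mul1r.
Qed.
Fact umulr1 : right_id uone umul.
Proof.
by move=> a; apply: ueaP => B f hf; rewrite ulift_mul // ulift_one // mulr1.
Qed.
Fact umulDl : left_distributive umul +%R.
Proof.
move=> a b c; apply: ueaP => B f hf.
by rewrite ulift_mul // !ulift_add // !ulift_mul // mulrDl.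
Qed.
Fact umulDr : right_distributive umul +%R.
Proof.
move=> a b c; apply: ueaP => B f hf.
by rewrite ulift_mul // !ulift_add // !ulift_mul // mulrDr.
Qed.

Fact lie_hom0 (B : algType k) : lie_hom (fun _ : L => 0 : B).
Proof. by split=> [a x y | x y]; rewrite ?scaler0 ?addr0 // mulr0 subr0. Qed.

Fact uone_neq0 : uone != 0.
Proof.
apply/eqP => /(congr1 (ulift (fun=> 0 : k^o))).
rewrite ulift_one ?ulift_zero; try exact: lie_hom0.
by move/eqP; rewrite oner_eq0.
Qed.

HB.instance Definition _ := GRing.Zmodule_isNzRing.Build uea
  umulA umul1 umulr1 umulDl umulDr uone_neq0.

Fact uscaleA c d a : uscale c (uscale d a) = uscale (c * d) a.
Proof. by apply: ueaP => B f hf; rewrite !ulift_scale // scalerA. Qed.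
Fact uscale1 : left_id 1 uscale.
Proof. by move=> a; apply: ueaP => B f hf; rewrite ulift_scale // scale1r. Qed.
Fact uscaleDr : right_distributive uscale +%R.
Proof.
move=> c a b; apply: ueaP => B f hf.
by rewrite ulift_scale // !ulift_add // !ulift_scale // scalerDr.
Qed.
Fact uscaleDl a : {morph uscale^~ a : c d / c + d}.
Proof.
move=> c d; apply: ueaP => B f hf.
by rewrite ulift_add // !ulift_scale // scalerDl.
Qed.

HB.instance Definition _ := GRing.Zmodule_isLmodule.Build k uea
  uscaleA uscale1 uscaleDr uscaleDl.

Fact uscaleAl (c : k) (a b : uea) : c *: (a * b) = (c *: a) * b.
Proof.
apply: ueaP => B f hf.
by rewrite ulift_scale // !ulift_mul // ulift_scale // scalerAl.
Qed.
HB.instance Definition _ := GRing.Lmodule_isLalgebra.Build k uea uscaleAl.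

Fact uscaleAr (c : k) (a b : uea) : c *: (a * b) = a * (c *: b).
Proof.
apply: ueaP => B f hf.
by rewrite ulift_scale // !ulift_mul // ulift_scale // scalerAr.
Qed.
HB.instance Definition _ := GRing.Lalgebra_isAlgebra.Build k uea uscaleAr.

Lemma uiota_hom : lie_hom (uiota : L -> uea).
Proof.
split=> [a x y | x y]; apply: ueaP => B f hf.
  by rewrite ulift_add // ulift_scale // !ulift_iota // hf.1.
by rewrite ulift_add // ulift_opp // !ulift_mul // !ulift_iota // hf.2.
Qed.

Lemma ulift_linear (B : algType k) (f : L -> B) : lie_hom f -> linear (ulift f).
Proof. by move=> hf a x y; rewrite ulift_add // ulift_scale. Qed.

Lemma ulift_multiplicative (B : algType k) (f : L -> B) :
  lie_hom f -> {morph ulift f : a b / a * b} /\ ulift f 1 = 1.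
Proof. by move=> hf; split=> [a b|]; [exact: ulift_mul | exact: ulift_one]. Qed.

Lemma ueaE (a : uea) :
  a = \sum_(p <- urepr a) p.1 *: \prod_(x <- p.2) uiota x.
Proof.
apply: ueaP => B f hf.
pose F := HB.pack_for {linear uea -> B} (ulift f)
  (GRing.isLinear.Build _ _ _ _ (ulift f) (ulift_linear hf)).
rewrite [RHS](linear_sum F); apply: eq_bigr => p _.
rewrite [RHS](linearZ_LR F) /=; congr (_ *: _); elim: p.2 => [|x w IHw].
  by rewrite !big_nil ulift_one.
by rewrite !big_cons ulift_mul // ulift_iota // IHw.
Qed.

Lemma ulift_unique (B : algType k) (f : L -> B) (g : uea -> B) :
  linear g -> {morph g : a b / a * b} -> g 1 = 1 ->
  (forall x, g (uiota x) = f x) -> g =1 ulift f.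
Proof.
move=> lg mg g1 gf a; rewrite [in LHS](ueaE a) /ulift /usum.
pose G := HB.pack_for {linear uea -> B} g (GRing.isLinear.Build _ _ _ _ g lg).
rewrite [LHS](linear_sum G); apply: eq_bigr => p _.
rewrite [LHS](linearZ_LR G) /=; congr (_ *: _); elim: p.2 => [|x w IHw].
  by rewrite !big_nil g1.
by rewrite !big_cons mg gf IHw.
Qed.

Definition coshuffle : uea -> tensor uea uea :=
  ulift (fun x => tens (uiota x) 1 + tens 1 (uiota x)).

Lemma coshuffle_hom :
  lie_hom (fun x => tens (uiota x) 1 + tens 1 (uiota x) : tensor uea uea).
Proof.
have bt := @tens_bilinear k uea uea; have [li hi] := uiota_hom.
split=> [a x y | x y] /=.
  rewrite !li (bilinDl bt) (bilinZl bt) (bilinDr bt) (bilinZr bt).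
  by rewrite scalerDr addrACA.
rewrite hi !mulrDl !mulrDr !tens_mul !(mul1r, mulr1) (bilinDl bt) (bilinDr bt).
rewrite -!scaleN1r (bilinZl bt) (bilinZr bt) !scaleN1r.
set a := tens (_ * _) 1; set b := tens (_ * _) 1.
set c := tens 1 _; set d := tens 1 _; set e := tens _ _; set g := tens _ _.
have swap p q r t : p + q + (r + t) = (p + t) + (q + r) :> tensor uea uea.
  by rewrite [r + t]addrC addrACA.
rewrite (swap a e) (swap b g) [g + e]addrC [in RHS]opprD [RHS]addrACA subrr addr0.
by rewrite [in RHS]opprD [RHS]addrACA.
Qed.

Lemma coshuffle_linear : linear coshuffle.
Proof. exact: ulift_linear coshuffle_hom. Qed.

Lemma coshuffle_multiplicative :
  {morph coshuffle : a b / a * b} /\ coshuffle 1 = 1.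
Proof. exact: ulift_multiplicative coshuffle_hom. Qed.

Lemma coshuffle_iota x :
  coshuffle (uiota x) = tens (uiota x) 1 + tens 1 (uiota x).
Proof. exact: ulift_iota coshuffle_hom x. Qed.

End UniversalEnvelopingAlgebra.

Arguments uea {k} L.
Arguments uiota {k L} x.
Arguments coshuffle {k L} a.

Section PostLieExtension.
Variables (k : fieldType) (A : postLieAlgType k).

(* uea A is the enveloping algebra of the Lie algebra underlying A, for the
   bracket lie (not for the composition bracket of the post-Lie algebra). *)
Record postlie_extension (tr : uea A -> uea A -> uea A) : Prop := {
  pext_bilinear : is_bilinear tr;
  pext_iota : forall x y : A, tr (uiota x) (uiota y) = uiota (postlie x y);
  pext_one : forall a, tr 1 a = a;
  pext_mull : forall (x y : A) a,
    tr (uiota x * a) (uiota y) =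
    tr (uiota x) (tr a (uiota y)) - tr (tr (uiota x) a) (uiota y);
  pext_mulr : forall a b c,
    tr a (b * c) = \sum_(p <- sweedler (coshuffle a)) tr p.1 b * tr p.2 c
}.

Definition gl_product (tr : uea A -> uea A -> uea A) (a b : uea A) : uea A :=
  \sum_(p <- sweedler (coshuffle a)) p.1 * tr p.2 b.

End PostLieExtension.

Section Hopf.
Variables (k : fieldType) (H : lmodType k).
Variables (m : H -> H -> H) (u : H) (D : H -> tensor H H).
Variables (e : H -> k) (S : H -> H).

Record algebra_axioms : Prop := {
  alg_bilinear : is_bilinear m;
  alg_assoc : associative m;
  alg_unitl : left_id u m;
  alg_unitr : right_id u m
}.

Record coalgebra_axioms : Prop := {
  coalg_linear : linear D;
  coalg_counit_linear : scalar e;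
  coalg_coassoc : forall a, tassoc (tmap D id (D a)) = tmap id D (D a);
  coalg_counitl : forall a, \sum_(p <- sweedler (D a)) e p.1 *: p.2 = a;
  coalg_counitr : forall a, \sum_(p <- sweedler (D a)) e p.2 *: p.1 = a
}.

Record bialgebra_axioms : Prop := {
  bialg_algebra : algebra_axioms;
  bialg_coalgebra : coalgebra_axioms;
  bialg_comul_mul : forall a b, D (m a b) = tmul m m (D a) (D b);
  bialg_comul_unit : D u = tens u u;
  bialg_counit_mul : forall a b, e (m a b) = e a * e b;
  bialg_counit_unit : e u = 1
}.

Record hopf_axioms : Prop := {
  hopf_bialgebra : bialgebra_axioms;
  hopf_antipode_linear : linear S;
  hopf_antipodel : forall a, \sum_(p <- sweedler (D a)) m (S p.1) p.2 = e a *: u;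
  hopf_antipoder : forall a, \sum_(p <- sweedler (D a)) m p.1 (S p.2) = e a *: u
}.

End Hopf.

(* The unit, the counit and the antipode of a Hopf algebra are determined by
   its product and its coproduct. *)
Definition is_hopf_algebra (k : fieldType) (H : lmodType k)
    (m : H -> H -> H) (D : H -> tensor H H) : Prop :=
  exists (u : H) (e : H -> k) (S : H -> H), hopf_axioms m u D e S.

(* Main.v *)
Require Import Defs.
From mathcomp Require Import all_boot all_order all_algebra.
From mathcomp Require Import boolp.

(** Write x, y for elements of the post-Lie algebra, seen in the enveloping
algebra U, let A * B be the new product and AB the concatenation.

The identities on |> are multilinear and are proved by induction over words.
They rest on three facts: a generator x acts through |> as a derivation of the
concatenation ([iota_trM]), kills 1 ([iota_tr1]), and is a coderivation for the
coproduct ([cosum_iota_tr]).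

Associativity.  The defining rule (xA) |> y = x |> (A |> y) - (x |> A) |> y
propagates from y to the whole of U ([iotaM_tr]).  The base case of that
induction is A |> 1 = eps(A) 1, which holds because A |-> A |> 1 is an
idempotent of the convolution algebra with value 1 at 1, and such an idempotent
is the convolution unit, the coproduct being conilpotent ([tr1]).  The
extended rule gives (x * A) * B = x * (A * B) ([gl_iotaA]).  Since
xA = x * A - x |> A and x |> A is not longer than A, left *-multiplications by
generators reach the whole of U starting from 1 ([gl_ind]).  Associativity,
right unitality, and the compatibility of * with the coproduct and the counit
are then all proved by induction along *, with [gl_iotaA] as inductive step.

Antipode.  For any associative product on U with unit 1, let J be the
difference between the convolution unit and the identity map.  The convolution
inverse of the identity is the Neumann series of the convolution powers of J.
As J kills 1, its n-th power kills all words of length < n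
([opp_aug_pow_filt0]), so that the series is finite at each element
([antipode_exists]).  Word length enters only as a filtration of U, so that
the relations of U raise no question of well-definedness. *)

Set Implicit Arguments.
Unset Strict Implicit.
Unset Printing Implicit Defensive.

Import GRing.Theory.
Local Open Scope ring_scope.

(** * Linearity side conditions *)

Section LinearCalculus.
Variables (k : fieldType) (U V W X : lmodType k).

Lemma lin_id : linear (fun u : U => u). Proof. by []. Qed.

Lemma lin0 (f : U -> V) : linear f -> f 0 = 0.
Proof. by move=> lf; have := lf (-1) 0 0; rewrite !scaleN1r !addNr. Qed.

Lemma linD (f : U -> V) : linear f -> {morph f : u v / u + v}.
Proof. by move=> lf u v; rewrite -[u]scale1r lf !scale1r. Qed.

Lemma linZ (f : U -> V) : linear f -> forall c u, f (c *: u) = c *: f u.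
Proof. by move=> lf c u; rewrite -[c *: u]addr0 lf (lin0 lf) addr0. Qed.

Lemma linB (f : U -> V) : linear f -> {morph f : u v / u - v}.
Proof. by move=> lf u v; rewrite -scaleN1r (linD lf) (linZ lf) scaleN1r. Qed.

Lemma lin_add (f g : U -> V) :
  linear f -> linear g -> linear (fun u => f u + g u).
Proof. by move=> lf lg c u v; rewrite lf lg scalerDr addrACA. Qed.

Lemma lin_opp (f : U -> V) : linear f -> linear (fun u => - f u).
Proof. by move=> lf c u v; rewrite lf opprD scalerN. Qed.

Lemma lin_scale a (f : U -> V) : linear f -> linear (fun u => a *: f u).
Proof. by move=> lf c u v; rewrite lf scalerDr !scalerA mulrC. Qed.

Lemma lin_coef (e : U -> k) (b : V) : scalar e -> linear (fun u => e u *: b).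
Proof. by move=> le c u v; rewrite le scalerDl scalerA. Qed.

Lemma lin_sum I (r : seq I) (P : pred I) (F : I -> U -> V) :
  (forall i, linear (F i)) -> linear (fun u => \sum_(i <- r | P i) F i u).
Proof.
move=> lF c u v; rewrite scaler_sumr -big_split.
by apply: eq_bigr => i _; rewrite lF.
Qed.

Lemma lin_comp (g : V -> W) (f : U -> V) :
  linear g -> linear f -> linear (fun u => g (f u)).
Proof. by move=> lg lf c u v; rewrite lf lg. Qed.

Lemma lin_bilinl (m : V -> W -> X) (f : U -> V) b :
  is_bilinear m -> linear f -> linear (fun u => m (f u) b).
Proof. by move=> bm lf c u v; rewrite lf (bilinDl bm) (bilinZl bm). Qed.

Lemma lin_bilinr (m : V -> W -> X) (f : U -> W) b :
  is_bilinear m -> linear f -> linear (fun u => m b (f u)).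
Proof. by move=> bm lf c u v; rewrite lf (bilinDr bm) (bilinZr bm). Qed.

Lemma lin_bilin (m : V -> W -> X) b : is_bilinear m -> linear (m b).
Proof. by move=> bm; apply: bm.2. Qed.

Lemma lin_tlift_param (F : U -> V -> W -> X) t :
  (forall v w, linear (fun u => F u v w)) -> linear (fun u => tlift (F u) t).
Proof.
move=> lF c u v; rewrite /tlift scaler_sumr -big_split.
by apply: eq_bigr => p _; rewrite lF.
Qed.

End LinearCalculus.

Definition trilinear (k : fieldType) (U V W X : lmodType k)
    (F : U -> V -> W -> X) : Prop :=
  [/\ forall v w, linear (fun u => F u v w), forall u w, linear (fun v => F u v w)
    & forall u v, linear (F u v)].

Section TrilinearCalculus.
Variables (k : fieldType) (T U V W X : lmodType k) (F : U -> V -> W -> X).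
Hypothesis tF : trilinear F.

Lemma lin_tri1 (f : T -> U) b c : linear f -> linear (fun t => F (f t) b c).
Proof. by case: tF => l1 l2 l3 lf s u v; rewrite lf ?l1 ?l2 ?l3. Qed.
Lemma lin_tri2 (f : T -> V) a c : linear f -> linear (fun t => F a (f t) c).
Proof. by case: tF => l1 l2 l3 lf s u v; rewrite lf ?l1 ?l2 ?l3. Qed.
Lemma lin_tri3 (f : T -> W) a b : linear f -> linear (fun t => F a b (f t)).
Proof. by case: tF => l1 l2 l3 lf s u v; rewrite lf ?l1 ?l2 ?l3. Qed.

End TrilinearCalculus.

(** * Sweedler sums *)

Section CoshuffleSums.
Variables (k : fieldType) (L : lieAlgType k).
Local Notation U := (uea L).

(** Sweedler's F a_(1) a_(2): a bilinear F of the two tensor factors, summed over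
the coproduct of a.  The product of the theorem and all the convolutions below
are of this form by definition. *)
Definition cosum (X : lmodType k) (F : U -> U -> X) (a : U) : X :=
  tlift F (coshuffle a).

Section Basic.
Variables (T X Y : lmodType k).

Lemma lin_cosum (F : U -> U -> X) (f : T -> U) :
  is_bilinear F -> linear f -> linear (fun t => cosum F (f t)).
Proof.
by move=> bF lf c u v; rewrite lf /cosum coshuffle_linear tlift_linear.
Qed.

Lemma lin_cosum_param (F : T -> U -> U -> X) a :
  (forall u v, linear (fun t => F t u v)) -> linear (fun t => cosum (F t) a).
Proof. exact: lin_tlift_param. Qed.

Lemma eq_cosum (F G : U -> U -> X) a : F =2 G -> cosum F a = cosum G a.
Proof. by move=> FG; apply: eq_bigr => p _. Qed.

Lemma cosumD (F G : U -> U -> X) a :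
  cosum (fun u v => F u v + G u v) a = cosum F a + cosum G a.
Proof. exact: big_split. Qed.

Lemma cosumB (F G : U -> U -> X) a :
  cosum (fun u v => F u v - G u v) a = cosum F a - cosum G a.
Proof. exact: sumrB. Qed.

Lemma cosum0 a : cosum (fun _ _ => 0 : X) a = 0.
Proof. exact: big1. Qed.

Lemma lin_cosumE (g : X -> Y) (F : U -> U -> X) a :
  linear g -> g (cosum F a) = cosum (fun u v => g (F u v)) a.
Proof.
move=> lg; apply: (big_morph g); [exact: linD | exact: lin0].
Qed.

Section Unfold.
Variable F : U -> U -> X.
Hypothesis bF : is_bilinear F.

Lemma cosum1 : cosum F 1 = F 1 1.
Proof.
by rewrite /cosum (coshuffle_multiplicative L).2 -tens_one tlift_tens.
Qed.

(** The recursion on words behind all the inductions: the coproduct of x is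
x (x) 1 + 1 (x) x, and it is multiplicative. *)
Lemma cosum_iotaM x a :
  cosum F (uiota x * a) =
  cosum (fun u v => F (uiota x * u) v) a + cosum (fun u v => F u (uiota x * v)) a.
Proof.
rewrite /cosum (coshuffle_multiplicative L).1 coshuffle_iota.
rewrite [in LHS](tensorE (coshuffle a)) mulr_sumr.
have lF := tlift_linear bF.
rewrite (big_morph _ (linD lF) (lin0 lF)) -big_split; apply: eq_bigr => p _ /=.
by rewrite mulrDl !tens_mul !mul1r (linD lF) !tlift_tens.
Qed.

End Unfold.
End Basic.
End CoshuffleSums.

Lemma bilin_intro (k : fieldType) (U V W : lmodType k) (F : U -> V -> W) :
  (forall v, linear (fun u => F u v)) -> (forall u, linear (fun v => F u v)) ->
  is_bilinear F.
Proof. by split=> [v|u]. Qed.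

(** Proves that an expression is linear in its abstracted argument, or bilinear
or trilinear in its two or three arguments, by descending to that argument.
The initial match rejects abstractions whose argument does not occur: they are
never linear, and searching them makes nested sums very slow. *)
Ltac lin :=
  cbv beta;
  lazymatch goal with
  | |- @GRing.linear_for _ _ _ _ (fun _ => ?b) => fail
  | |- _ => idtac
  end;
  first
    [ assumption
    | exact: lin_id
    | exact: tens_bilinear
    | exact: mul_bilinear
    | refine (bilin_intro _ _); intros ?; lin
    | lazymatch goal with |- trilinear _ => split; intros ? ?; lin end
    | refine (lin_add _ _); lin
    | refine (lin_opp _); lin
    | refine (lin_scale _ _); lin
    | refine (lin_cosum _ _); lin
    | refine (lin_cosum_param _ _); intros ? ?; lin
    | refine (lin_bilinl _ _ _); [ lin_bil | lin ]
    | refine (lin_bilinr _ _ _); [ lin_bil | lin ]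
    | refine (lin_bilin _ _); lin_bil
    | refine (lin_tri1 _ _ _ _); [ eassumption | lin ]
    | refine (lin_tri2 _ _ _ _); [ eassumption | lin ]
    | refine (lin_tri3 _ _ _ _); [ eassumption | lin ]
    | match goal with H : linear _ |- _ => refine (lin_comp H _); lin end ]
with lin_bil := first [ assumption | exact: tens_bilinear | exact: mul_bilinear ].

(** * The coshuffle coalgebra *)

Section EnvelopingCoalgebra.
Variables (k : fieldType) (L : lieAlgType k).
Local Notation U := (uea L).
Local Notation D := (coshuffle : U -> tensor U U).

Lemma uea_ind (P : U -> Prop) :
  P 1 -> (forall x a, P a -> P (uiota x * a)) ->
  (forall c a b, P a -> P b -> P (c *: a + b)) -> forall a, P a.
Proof.
move=> P1 PM PL a.
have P0 : P 0 by rewrite -[0](addNr 1) -scaleN1r; apply: PL.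
rewrite (ueaE a); elim: (urepr a) => [|p s IHs]; first by rewrite big_nil.
rewrite big_cons; apply: PL => //; elim: p.2 => [|x w IHw].
  by rewrite big_nil.
by rewrite big_cons; apply: PM.
Qed.

Lemma uea_lin_eq (X : lmodType k) (f g : U -> X) :
  linear f -> linear g -> f 1 = g 1 ->
  (forall x a, f a = g a -> f (uiota x * a) = g (uiota x * a)) -> f =1 g.
Proof.
move=> lf lg f1 fM; apply: uea_ind => // c a b fa fb.
by rewrite lf lg fa fb.
Qed.

Lemma cosum_iota (X : lmodType k) (F : U -> U -> X) x :
  is_bilinear F -> cosum F (uiota x) = F (uiota x) 1 + F 1 (uiota x).
Proof.
by move=> bF; rewrite -[uiota x in LHS]mulr1 cosum_iotaM ?cosum1 ?mulr1 //; lin.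
Qed.

Definition counit : U -> k := ulift (fun=> 0 : k^o).

Lemma counit_scalar : scalar counit.
Proof. exact: (ulift_linear (lie_hom0 L k^o)). Qed.

Lemma counitD a b : counit (a + b) = counit a + counit b.
Proof. by have := counit_scalar 1 a b; rewrite scale1r mul1r. Qed.

Lemma counit0 : counit 0 = 0.
Proof. by apply: (addIr (counit 0)); rewrite -counitD !add0r. Qed.

Lemma counitM a b : counit (a * b) = counit a * counit b.
Proof. exact: (ulift_multiplicative (lie_hom0 L k^o)).1. Qed.

Lemma counit1 : counit 1 = 1.
Proof. exact: (ulift_multiplicative (lie_hom0 L k^o)).2. Qed.

Lemma counit_iota x : counit (uiota x) = 0.
Proof. exact: (ulift_iota (lie_hom0 L k^o)). Qed.

Lemma lin_counit (V : lmodType k) (b : V) : linear (fun a : U => counit a *: b).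
Proof. exact: lin_coef counit_scalar. Qed.

Lemma cosum_counitl a : cosum (fun u v => counit u *: v) a = a.
Proof.
have bF : is_bilinear (fun u v : U => counit u *: v).
  by apply: bilin_intro => ?; [exact: lin_counit | lin].
move: a; apply: uea_lin_eq; first by lin.
- exact: lin_id.
- by rewrite cosum1 // counit1 scale1r.
move=> x a IH; rewrite cosum_iotaM //.
rewrite (eq_cosum (G := fun _ _ => 0)) => [|u v].
  rewrite cosum0 add0r -[in RHS]IH.
  rewrite (lin_cosumE (g := fun v => uiota x * v)); last by lin.
  by apply: eq_cosum => u v; rewrite scalerAr.
by rewrite counitM counit_iota mul0r scale0r.
Qed.

Lemma cosum_counitr a : cosum (fun u v => counit v *: u) a = a.
Proof.
have bF : is_bilinear (fun u v : U => counit v *: u).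
  by apply: bilin_intro => ?; [lin | exact: lin_counit].
move: a; apply: uea_lin_eq; first by lin.
- exact: lin_id.
- by rewrite cosum1 // counit1 scale1r.
move=> x a IH; rewrite cosum_iotaM // addrC.
rewrite (eq_cosum (G := fun _ _ => 0)) => [|u v].
  rewrite cosum0 add0r -[in RHS]IH.
  rewrite (lin_cosumE (g := fun v => uiota x * v)); last by lin.
  by apply: eq_cosum => u v; rewrite scalerAr.
by rewrite counitM counit_iota mul0r scale0r.
Qed.

(** Coassociativity against an arbitrary trilinear F, which has to vary in the
induction: each of the three places where a new letter x can go turns F into
another trilinear map. *)
Lemma cosum_coassoc (X : lmodType k) (F : U -> U -> U -> X) a :
  trilinear F ->
  cosum (fun u v => cosum (fun c d => F c d v) u) a =
  cosum (fun u v => cosum (F u) v) a.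
Proof.
elim/uea_ind: a F => [|x a IH|s a b IHa IHb] F tF.
- by rewrite !cosum1 //; lin.
- rewrite [LHS]cosum_iotaM; last by lin.
  rewrite (eq_cosum (G := fun u v => cosum (fun c d => F (uiota x * c) d v) u
    + cosum (fun c d => F c (uiota x * d) v) u)) => [|u v]; last first.
    by rewrite cosum_iotaM //; lin.
  rewrite cosumD (IH (fun c => F (uiota x * c))); last by lin.
  rewrite (IH (fun c d => F c (uiota x * d))); last by lin.
  rewrite (IH (fun c d v => F c d (uiota x * v))); last by lin.
  rewrite cosum_iotaM; last by lin.
  rewrite -addrA; congr (_ + _); rewrite -cosumD; apply: eq_cosum => u v.
  by rewrite cosum_iotaM //; lin.
have lL : linear (fun a => cosum (fun u v => cosum (fun c d => F c d v) u) a).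
  by lin.
have lR : linear (fun a => cosum (fun u v => cosum (F u) v) a) by lin.
by rewrite lL lR IHa // IHb.
Qed.

Lemma coshuffleE a : D a = cosum tens a.
Proof. exact: tensorE. Qed.

Lemma coshuffle_coassoc a : tassoc (tmap D id (D a)) = tmap id D (D a).
Proof.
have bt (w : U) : is_bilinear (fun u v : U => tens u (tens v w)) by lin.
have ba : is_bilinear
    (fun s w => tlift (fun u v : U => tens u (tens v w)) s : tensor U (tensor U U)).
  refine (bilin_intro _ _) => [w|s]; first exact: (tlift_linear (bt w)).
  by refine (lin_tlift_param _ _) => u v; lin.
rewrite [LHS](lin_cosumE _ _ (tlift_linear ba)).
rewrite (eq_cosum (G := fun u v => cosum (fun c d => tens c (tens d v)) u)).
  rewrite (cosum_coassoc (F := fun u v w => tens u (tens v w))); last by lin.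
  apply: eq_cosum => u v; rewrite coshuffleE.
  by rewrite (lin_cosumE (g := fun t => tens u t)); last lin.
by move=> u v; rewrite tlift_tens.
Qed.

Lemma coshuffle_coalgebra : coalgebra_axioms D counit.
Proof.
split; [exact: coshuffle_linear | exact: counit_scalar | exact: coshuffle_coassoc
  | exact: cosum_counitl | exact: cosum_counitr].
Qed.

(** * The filtration by word length *)

(** The span of the words of length at most n is encoded inductively to induct on
membership without choosing an expression of the element in words. *)
Inductive ufilt : nat -> U -> Prop :=
| ufilt1 n : ufilt n 1
| ufiltM n x a : ufilt n a -> ufilt n.+1 (uiota x * a)
| ufiltL n c a b : ufilt n a -> ufilt n b -> ufilt n (c *: a + b).

Lemma ufilt_leq m n a : (m <= n)%N -> ufilt m a -> ufilt n a.
Proof.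
move=> lemn fa; elim: fa n lemn => {m a}
  [m|m x a _ IH|m c a b _ IHa _ IHb] n lemn; first exact: ufilt1.
  by case: n lemn => // n lemn; apply/ufiltM/IH.
by apply: ufiltL; [apply: IHa | apply: IHb].
Qed.

Lemma ufilt_exists a : exists n, ufilt n a.
Proof.
elim/uea_ind: a => [|x a [n fa]|c a b [n fa] [m fb]].
- by exists 0; apply: ufilt1.
- by exists n.+1; apply: ufiltM.
exists (maxn n m); apply: ufiltL.
  by apply: ufilt_leq fa; apply: leq_maxl.
by apply: ufilt_leq fb; apply: leq_maxr.
Qed.

Lemma ufilt0 n a : ufilt n a -> n = 0%N -> exists c : k, a = c%:A.
Proof.
move=> fa; elim: fa => {n a} [n|//|n c a b _ IHa _ IHb] n0.
  by exists 1; rewrite scale1r.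
have [[d ->] [e ->]] := (IHa n0, IHb n0).
by exists (c * d + e); rewrite scalerDl scalerA.
Qed.

(** The coproduct is filtered: it sends filtration degree n into the sum of the
products of degrees i and j with i + j <= n.  The dual form, by vanishing of
bilinear maps, is what conilpotency arguments use. *)
Lemma cosum_filt0 (X : lmodType k) n a (F : U -> U -> X) :
  is_bilinear F -> ufilt n a ->
  (forall i j u v, (i + j <= n)%N -> ufilt i u -> ufilt j v -> F u v = 0) ->
  cosum F a = 0.
Proof.
move=> bF fa; elim: fa F bF => {n a} [n|n x a _ IH|n c a b _ IHa _ IHb] F bF F0.
- by rewrite cosum1 // (F0 0%N 0%N) //; apply: ufilt1.
- rewrite cosum_iotaM // !IH ?addr0 //; try by lin.
  + move=> i j u v le_ij fu fv.
    by apply: (F0 i j.+1) => //; [rewrite addnS | apply: ufiltM].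
  + move=> i j u v le_ij fu fv.
    by apply: (F0 i.+1 j) => //; apply: ufiltM.
have lF : linear (fun a => cosum F a) by lin.
by rewrite lF IHa // IHb // scaler0 addr0.
Qed.

End EnvelopingCoalgebra.

Arguments counit {k L} a.

(** * Existence of antipodes *)

Section Antipode.
Variables (k : fieldType) (L : lieAlgType k).
Local Notation U := (uea L).
Variable m : U -> U -> U.
Hypothesis algm : algebra_axioms m 1.

Let bm : is_bilinear m := alg_bilinear algm.

Definition conv (f g : U -> U) (a : U) : U := cosum (fun u v => m (f u) (g v)) a.

Definition conv_unit (a : U) : U := counit a *: 1.

(** Minus the projection onto the augmentation ideal along the line of 1. *)
Definition opp_aug (a : U) : U := conv_unit a - a.

Definition opp_aug_pow n : U -> U := iter n (conv opp_aug) conv_unit.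

Lemma lin_conv_unit : linear conv_unit. Proof. exact: lin_counit. Qed.

Lemma lin_opp_aug : linear opp_aug.
Proof. have l1 := lin_conv_unit; rewrite /opp_aug; lin. Qed.

Lemma lin_conv f g : linear f -> linear g -> linear (conv f g).
Proof. by move=> lf lg; rewrite /conv; lin. Qed.

Lemma lin_opp_aug_pow n : linear (opp_aug_pow n).
Proof.
elim: n => [|n IHn]; first exact: lin_conv_unit.
exact: lin_conv lin_opp_aug IHn.
Qed.

Lemma eq_conv f f' g g' : f =1 f' -> g =1 g' -> conv f g =1 conv f' g'.
Proof. by move=> ff' gg' a; apply: eq_cosum => u v; rewrite ff' gg'. Qed.

Lemma convA f g h : linear f -> linear g -> linear h ->
  conv (conv f g) h =1 conv f (conv g h).
Proof.
move=> lf lg lh a.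
transitivity (cosum (fun u v => cosum (fun c d => m (m (f c) (g d)) (h v)) u) a).
  by apply: eq_cosum => u v; rewrite (lin_cosumE (g := m^~ (h v))) //; lin.
rewrite (cosum_coassoc (F := fun c d v => m (m (f c) (g d)) (h v))); last by lin.
apply: eq_cosum => u v; rewrite [RHS](lin_cosumE (g := m (f u))) //; last by lin.
by apply: eq_cosum => c d; rewrite (alg_assoc algm).
Qed.

Lemma conv_unitl f : linear f -> conv conv_unit f =1 f.
Proof.
move=> lf a; rewrite -[in RHS](cosum_counitl a) (lin_cosumE _ _ lf).
by apply: eq_cosum => u v; rewrite (bilinZl bm) (alg_unitl algm) (linZ lf).
Qed.

Lemma conv_unitr f : linear f -> conv f conv_unit =1 f.
Proof.
move=> lf a; rewrite -[in RHS](cosum_counitr a) (lin_cosumE _ _ lf).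
by apply: eq_cosum => u v; rewrite (bilinZr bm) (alg_unitr algm) (linZ lf).
Qed.

(** Powers are built by multiplying on the left, while the left antipode law
multiplies on the right. *)
Lemma opp_aug_powSr n : conv (opp_aug_pow n) opp_aug =1 opp_aug_pow n.+1.
Proof.
have lJ := lin_opp_aug; elim: n => [|n IHn] a.
  by rewrite conv_unitl // [RHS]conv_unitr.
rewrite convA //; last exact: lin_opp_aug_pow.
exact: eq_conv.
Qed.

Lemma opp_aug_scalar (c : k) : opp_aug c%:A = 0.
Proof.
by rewrite (linZ lin_opp_aug) /opp_aug /conv_unit counit1 scale1r subrr scaler0.
Qed.

(** In a term [m (opp_aug u) (opp_aug_pow n v)] of the power n + 1, either u has
degree 0 and the first factor vanishes, or v has smaller degree than a and the
second one does. *)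
Lemma opp_aug_pow_filt0 i n a : ufilt i a -> (i < n)%N -> opp_aug_pow n a = 0.
Proof.
elim: n i a => // n IHn i a fa lt_in.
have [lJ lJn] := (lin_opp_aug, lin_opp_aug_pow n).
apply: (cosum_filt0 (F := fun u v => m (opp_aug u) (opp_aug_pow n v)) _ fa).
  by lin.
move=> p q u v le_pqi fu fv.
case: p => [|p] in le_pqi fu *.
  by have [c ->] := ufilt0 fu erefl; rewrite opp_aug_scalar (bilin0l bm).
rewrite (IHn q v fv) ?(bilin0r bm) //.
by apply: leq_trans (leq_trans le_pqi lt_in); rewrite addSn ltnS leq_addl.
Qed.

Definition neumann N (a : U) : U := \sum_(i < N) opp_aug_pow i a.

Lemma neumannS N a : neumann N.+1 a = neumann N a + opp_aug_pow N a.
Proof. exact: big_ord_recr. Qed.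

Lemma lin_neumann N : linear (neumann N).
Proof. by apply: (lin_sum _ _) => i; apply: lin_opp_aug_pow. Qed.

Lemma conv_id_r f a : linear f -> conv f id a = f a - conv f opp_aug a.
Proof.
move=> lf; rewrite -[in X in X - _](conv_unitr lf) -cosumB.
by apply: eq_cosum => u v; rewrite -(linB (bm.2 _)) /opp_aug subKr.
Qed.

Lemma conv_id_l f a : linear f -> conv id f a = f a - conv opp_aug f a.
Proof.
move=> lf; rewrite -[in X in X - _](conv_unitl lf) -cosumB.
by apply: eq_cosum => u v; rewrite -(linB (bm.1 _)) /opp_aug subKr.
Qed.

(** As the identity map is [conv_unit - opp_aug], the sum telescopes. *)
Lemma neumann_conv_id N a : conv (neumann N) id a = conv_unit a - opp_aug_pow N a.
Proof.
elim: N => [|N IHN].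
  rewrite subrr -(cosum0 _ a); apply: eq_cosum => u v.
  by rewrite /neumann big_ord0 (bilin0l bm).
transitivity (conv (neumann N) id a + conv (opp_aug_pow N) id a).
  rewrite -cosumD; apply: eq_cosum => u v.
  by rewrite neumannS (bilinDl bm).
rewrite IHN conv_id_r ?opp_aug_powSr ?addrA ?subrK //.
exact: lin_opp_aug_pow.
Qed.

Lemma id_conv_neumann N a : conv id (neumann N) a = conv_unit a - opp_aug_pow N a.
Proof.
elim: N => [|N IHN].
  rewrite subrr -(cosum0 _ a); apply: eq_cosum => u v.
  by rewrite /neumann big_ord0 (bilin0r bm).
transitivity (conv id (neumann N) a + conv id (opp_aug_pow N) a).
  rewrite -cosumD; apply: eq_cosum => u v.
  by rewrite neumannS (bilinDr bm).
rewrite IHN conv_id_l ?addrA ?subrK //.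
exact: lin_opp_aug_pow.
Qed.

(** The Neumann sums are stationary at each element, so that a chosen bound N for
its length defines the limit S.  Linearity of S, and its antipode laws, hold
because on the finitely many elements involved S agrees with one and the same
partial sum. *)
Lemma antipode_exists : exists S : U -> U,
  [/\ linear S, conv S id =1 conv_unit & conv id S =1 conv_unit].
Proof.
have [N fN] := choice (@ufilt_exists k L).
pose S a := neumann (N a).+1 a.
have SE n a : ufilt n a -> S a = neumann n.+1 a.
  have neumannE i p : ufilt i a -> (i <= p)%N -> neumann p.+1 a = neumann i.+1 a.
    move=> fa; elim: p => [|p IHp]; first by rewrite leqn0 => /eqP->.
    rewrite leq_eqVlt => /predU1P[-> // | lt_ip].
    rewrite neumannS (opp_aug_pow_filt0 fa lt_ip) addr0.
    exact: IHp.
  move=> fa; rewrite /S -(neumannE _ (maxn n (N a)) (fN a)) ?leq_maxr //.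
  by rewrite -(neumannE _ (maxn n (N a)) fa) ?leq_maxl.
have lS : linear S.
  move=> c a b; pose n := maxn (N a) (N b).
  have fa : ufilt n a by apply: ufilt_leq (fN a); apply: leq_maxl.
  have fb : ufilt n b by apply: ufilt_leq (fN b); apply: leq_maxr.
  by rewrite !(SE n) //; [apply: lin_neumann | apply: ufiltL].
exists S; split=> // a; have fa := fN a; set n := N a in fa.
all: have lG := lin_neumann n.+1; have J0 := opp_aug_pow_filt0 fa (ltnSn n).
  have <- : conv (neumann n.+1) id a = conv_unit a.
    by rewrite neumann_conv_id J0 subr0.
  apply/eqP; rewrite -subr_eq0 -cosumB; apply/eqP.
  apply: (cosum_filt0 _ fa) => [|i j u v le_ijn fu fv]; first by lin.
  rewrite (SE n) ?subrr //; apply: ufilt_leq fu.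
  exact: leq_trans (leq_addr _ _) le_ijn.
have <- : conv id (neumann n.+1) a = conv_unit a.
  by rewrite id_conv_neumann J0 subr0.
apply/eqP; rewrite -subr_eq0 -cosumB; apply/eqP.
apply: (cosum_filt0 _ fa) => [|i j u v le_ijn fu fv]; first by lin.
rewrite (SE n) ?subrr //; apply: ufilt_leq fv.
exact: leq_trans (leq_addl _ _) le_ijn.
Qed.

End Antipode.

(** * The Grossman-Larson product *)

Section GrossmanLarson.
Variables (k : fieldType) (A : postLieAlgType k).
Local Notation U := (uea A).
Variable tr : U -> U -> U.
Hypothesis ext : postlie_extension tr.
Local Notation "a |> b" := (tr a b) (at level 45, no associativity).
Local Notation "a ** b" := (gl_product tr a b) (at level 40, left associativity).

Let btr : is_bilinear tr := pext_bilinear ext.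

Lemma tr_mulr a b c : a |> (b * c) = cosum (fun u v => (u |> b) * (v |> c)) a.
Proof. exact: pext_mulr. Qed.

(** Expanding x |> (1 1) gives x |> 1 = x |> 1 + x |> 1. *)
Lemma iota_tr1 (x : A) : uiota x |> 1 = 0.
Proof.
apply: (addrI (uiota x |> 1)); rewrite addr0 -[in RHS](mulr1 1) tr_mulr.
by rewrite cosum_iota ?(pext_one ext) ?mulr1 ?mul1r //; lin.
Qed.

Lemma iota_trM (x : A) b c :
  uiota x |> (b * c) = (uiota x |> b) * c + b * (uiota x |> c).
Proof. by rewrite tr_mulr cosum_iota ?(pext_one ext) //; lin. Qed.

Lemma lin_tr (a : U) : linear (tr a). Proof. exact: btr.2. Qed.

Lemma counit_iota_tr (x : A) a : counit (uiota x |> a) = 0.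
Proof.
elim/uea_ind: a => [|y a IH|c a b IHa IHb].
- by rewrite iota_tr1 counit0.
- rewrite iota_trM (pext_iota ext) counitD.
  by rewrite !counitM counit_iota IH mul0r mulr0 addr0.
by rewrite lin_tr counit_scalar IHa IHb mulr0 addr0.
Qed.

(** The generators act as coderivations, because they act as derivations and send
generators to generators, which are primitive. *)
Lemma cosum_iota_tr (X : lmodType k) (F : U -> U -> X) (x : A) a :
  is_bilinear F ->
  cosum F (uiota x |> a) =
  cosum (fun u v => F (uiota x |> u) v + F u (uiota x |> v)) a.
Proof.
elim/uea_ind: a F => [|y a IH|c a b IHa IHb] F bF.
- rewrite iota_tr1 (lin0 (f := cosum F)); last by lin.
  rewrite cosum1; last by lin.
  by rewrite !iota_tr1 (bilin0l bF) (bilin0r bF) addr0.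
- rewrite iota_trM (pext_iota ext) (linD (f := cosum F)); last by lin.
  rewrite cosum_iotaM // cosum_iotaM // !IH; try by lin.
  rewrite cosum_iotaM -?cosumD; last by lin.
  apply: eq_cosum => u v; rewrite !iota_trM (pext_iota ext).
  rewrite !(bilinDl bF) !(bilinDr bF) -!addrA; congr (_ + _).
  by do 3!(rewrite [LHS]addrCA; congr (_ + _)).
have l1 : linear (fun a => cosum F (uiota x |> a)) by lin.
have l2 : linear (fun a =>
  cosum (fun u v => F (uiota x |> u) v + F u (uiota x |> v)) a) by lin.
by rewrite l1 l2 IHa // IHb.
Qed.

(** The map a |-> a |> 1 is a convolution idempotent by [tr_mulr] for 1 1 = 1.
Hence its difference h with the convolution unit satisfies h = - h * h for the
convolution; as h kills 1, the value of h at a word is a sum of products of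
values of h at strictly shorter words, hence zero. *)
Lemma tr1 a : a |> 1 = counit a *: 1.
Proof.
pose h b := b |> 1 - counit b *: 1.
have lc : linear (fun a : U => counit a *: (1 : U)) by exact: lin_counit.
have lh : linear h by rewrite /h; lin.
have hh b : h b = - cosum (fun u v => h u * h v) b.
  have -> : cosum (fun u v => h u * h v) b = b |> 1 - b |> 1 - h b.
    (* With f = (_ |> 1) and e the convolution unit, this is
       (f - e)(f - e) = f f - e f - (f - e) e. *)
    have -> : cosum (fun u v => h u * h v) b =
      cosum (fun u v => (u |> 1) * (v |> 1)) b -
      cosum (fun u v => counit u *: (v |> 1)) b -
      cosum (fun u v => counit v *: h u) b.
      rewrite -!cosumB; apply: eq_cosum => u v.
      by rewrite mulrBr mulrBl -!scalerAl -!scalerAr mul1r mulr1.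
    rewrite -tr_mulr mulr1; congr (_ - _ - _).
      rewrite -[in RHS](cosum_counitl b) (lin_cosumE _ _ (btr.1 _)).
      by apply: eq_cosum => u v; rewrite (bilinZl btr).
    rewrite -[in RHS](cosum_counitr b) (lin_cosumE _ _ lh).
    by apply: eq_cosum => u v; rewrite (linZ lh).
  by rewrite subrr sub0r opprK.
have h0 c : h c%:A = 0.
  by rewrite (linZ lh) /h (pext_one ext) counit1 scale1r subrr scaler0.
have [n fa] := ufilt_exists a.
suff: h a = 0 by move/eqP; rewrite subr_eq0 => /eqP.
elim/ltn_ind: n a fa => n IHn a fa; rewrite hh; apply/eqP; rewrite oppr_eq0.
apply/eqP; apply: (cosum_filt0 _ fa) => [|i j u v le_ijn fu fv]; first by lin.
have [i0|i_gt0] := posnP i.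
  by have [c ->] := ufilt0 fu i0; rewrite h0 mul0r.
have [j0|j_gt0] := posnP j.
  by have [c ->] := ufilt0 fv j0; rewrite h0 mulr0.
rewrite (IHn i) ?mul0r //; apply: leq_trans le_ijn.
by rewrite -[X in (X < _)%N]addn0 ltn_add2l.
Qed.

(** The rule that defines the action of xA on generators holds on the whole
algebra: both sides satisfy the same Leibniz formula in b, since x is a
coderivation. *)
Lemma iotaM_tr (x : A) a b :
  (uiota x * a) |> b = uiota x |> (a |> b) - (uiota x |> a) |> b.
Proof.
elim/uea_ind: b a => [|y b IH|c b d IHb IHd] a.
- rewrite !tr1 counitM counit_iota mul0r counit_iota_tr scale0r.
  by rewrite (linZ (lin_tr _)) iota_tr1 scaler0 subrr.
- rewrite !tr_mulr cosum_iotaM; last by lin.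
  rewrite cosum_iota_tr; last by lin.
  rewrite (lin_cosumE _ _ (lin_tr _)) -cosumD -cosumB; apply: eq_cosum => u v.
  rewrite (pext_mull ext) IH iota_trM mulrBl mulrBr opprD !addrA.
  by congr (_ + _); rewrite addrAC.
by rewrite !lin_tr IHb IHd scalerBr opprD addrACA.
Qed.

Lemma glE a b : a ** b = cosum (fun u v => u * (v |> b)) a.
Proof. by []. Qed.

Lemma gl_bilinear : is_bilinear (gl_product tr).
Proof.
have bgl : is_bilinear (fun a b : U => cosum (fun u v => u * (v |> b)) a) by lin.
exact: bgl.
Qed.

Lemma gl1l a : 1 ** a = a.
Proof. by rewrite glE cosum1 ?mul1r ?(pext_one ext) //; lin. Qed.

Lemma gl_iota (x : A) b : uiota x ** b = uiota x * b + uiota x |> b.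
Proof. by rewrite glE cosum_iota ?mul1r ?(pext_one ext) //; lin. Qed.

(** Associativity when the first factor is a generator.  Expanded by [iotaM_tr],
the terms with (x |> a_(2)) |> b in (x a) ** b cancel against the same terms
in (x |> a) ** b. *)
Lemma gl_iotaA (x : A) a b : (uiota x ** a) ** b = uiota x ** (a ** b).
Proof.
rewrite gl_iota (bilinDl gl_bilinear) [RHS]gl_iota !glE.
rewrite cosum_iotaM; last by lin.
rewrite cosum_iota_tr; last by lin.
rewrite (lin_cosumE _ _ (lin_tr _)).
rewrite (lin_cosumE (g := fun c => uiota x * c)); last by lin.
rewrite -!cosumD; apply: eq_cosum => u v.
by rewrite iotaM_tr iota_trM mulrA mulrBr -!addrA; congr (_ + _);
  rewrite [X in _ + (_ + X)]addrC addKr addrC.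
Qed.

Lemma ufilt_iota_tr (x : A) n a : ufilt n a -> ufilt n (uiota x |> a).
Proof.
have f0 m : ufilt m (0 : U).
  by rewrite -(addNr (1 : U)) -scaleN1r; apply: ufiltL; apply: ufilt1.
elim=> {n a} [n|n y a fa IH|n c a b _ IHa _ IHb].
- by rewrite iota_tr1; apply: f0.
- rewrite iota_trM (pext_iota ext) -[X in X + _]scale1r.
  by apply: ufiltL; apply: ufiltM.
by rewrite lin_tr; apply: ufiltL.
Qed.

(** Induction along the new product.  It follows by induction on the length from
x a = x ** a - x |> a, where x |> a is of the same length as a. *)
Lemma gl_ind (P : U -> Prop) :
  P 1 -> (forall (x : A) a, P a -> P (uiota x ** a)) ->
  (forall c a b, P a -> P b -> P (c *: a + b)) -> forall a, P a.
Proof.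
move=> P1 PM PL a; have [n] := ufilt_exists a.
elim: n a => [|n IHn] a fa.
  have [c ->] := ufilt0 fa erefl; have P0 : P 0.
    by rewrite -(addNr 1) -scaleN1r; apply: PL.
  by rewrite -[_ *: _]addr0; apply: PL.
move def_m: n.+1 fa => m fa.
elim: fa def_m => {m a} [//|m x a fa _ [def_m]|m c a b _ IHa _ IHb def_m].
  rewrite -def_m in fa.
  have -> : uiota x * a = -1 *: (uiota x |> a) + uiota x ** a.
    by rewrite gl_iota scaleN1r addrCA addNr addr0.
  by apply: PL; [apply/IHn/ufilt_iota_tr | apply/PM/IHn].
by apply: PL; [apply: IHa | apply: IHb].
Qed.

Lemma gl_assoc : associative (gl_product tr).
Proof.
have bg := gl_bilinear.
move=> a b c; elim/gl_ind: a => [|x a IH|s a d IHa IHd].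
- by rewrite !gl1l.
- by rewrite !gl_iotaA IH.
by rewrite !(bilinDl bg) !(bilinZl bg) IHa IHd.
Qed.

Lemma gl1r a : a ** 1 = a.
Proof.
have bg := gl_bilinear.
elim/gl_ind: a => [|x a IH|s a d IHa IHd]; first exact: gl1l.
  by rewrite gl_iotaA IH.
by rewrite !(bilinDl bg) !(bilinZl bg) IHa IHd.
Qed.

Lemma gl_algebra : algebra_axioms (gl_product tr) 1.
Proof.
by split; [exact: gl_bilinear | exact: gl_assoc | exact: gl1l | exact: gl1r].
Qed.

Lemma counit_gl a b : counit (a ** b) = counit a * counit b.
Proof.
have bg := gl_bilinear.
have ex (x : A) c : counit (uiota x ** c) = 0.
  by rewrite gl_iota counitD counitM counit_iota mul0r counit_iota_tr addr0.
elim/gl_ind: a => [|x a IH|s a d IHa IHd].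
- by rewrite gl1l counit1 mul1r.
- by rewrite gl_iotaA !ex mul0r.
by rewrite !(bilinDl bg) !(bilinZl bg) !counit_scalar IHa IHd mulrDl mulrA.
Qed.

Lemma cosum_gl_iota (X : lmodType k) (F : U -> U -> X) (x : A) a :
  is_bilinear F ->
  cosum F (uiota x ** a) =
  cosum (fun u v => F (uiota x ** u) v + F u (uiota x ** v)) a.
Proof.
move=> bF; rewrite gl_iota (linD (f := cosum F)); last by lin.
rewrite cosum_iotaM // cosum_iota_tr // -!cosumD; apply: eq_cosum => u v.
by rewrite !gl_iota (bilinDl bF) (bilinDr bF) addrACA.
Qed.

Lemma cosum_gl (X : lmodType k) (F : U -> U -> X) a b :
  is_bilinear F ->
  cosum F (a ** b) =
  cosum (fun u v => cosum (fun c d => F (u ** c) (v ** d)) b) a.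
Proof.
have bg := gl_bilinear.
elim/gl_ind: a F => [|x a IH|s a d IHa IHd] F bF.
- rewrite gl1l cosum1; last by lin.
  by apply: eq_cosum => u v; rewrite !gl1l.
- rewrite gl_iotaA cosum_gl_iota // IH; last by lin.
  rewrite cosum_gl_iota; last by lin.
  apply: eq_cosum => u v; rewrite -cosumD.
  by apply: eq_cosum => c d; rewrite !gl_iotaA.
have l1 : linear (fun a => cosum F (a ** b)) by lin.
have l2 : linear (fun a =>
  cosum (fun u v => cosum (fun c d => F (u ** c) (v ** d)) b) a) by lin.
by rewrite l1 l2 IHa // IHd.
Qed.

Lemma coshuffle_gl a b :
  coshuffle (a ** b) =
  tmul (gl_product tr) (gl_product tr) (coshuffle a) (coshuffle b).
Proof. by rewrite coshuffleE cosum_gl //; lin. Qed.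

End GrossmanLarson.

Theorem proposition3p3 (k : fieldType) (k_char0 : [pchar k] =i pred0)
    (A : postLieAlgType k) (tr : uea A -> uea A -> uea A)
    (tr_ext : postlie_extension tr) :
  associative (gl_product tr) /\
  is_hopf_algebra (gl_product tr) (coshuffle : uea A -> tensor (uea A) (uea A)).
Proof.
split; first exact: gl_assoc tr_ext.
have [S [lS SI IS]] := antipode_exists (gl_algebra tr_ext).
exists 1, counit, S; split; [split | exact: lS | exact: SI | exact: IS].
- exact: gl_algebra tr_ext.
- exact: coshuffle_coalgebra.
- exact: coshuffle_gl tr_ext.
- exact: (coshuffle_multiplicative A).2.
- exact: counit_gl tr_ext.
- exact: counit1.
Qed.
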